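(* Let $\mathbb{R}^{2}$ be endowed with the structure of a real nonassociative algebra having a basis $\{e_1,e_2\}$ and real numbers $a_{ij},b_{ij}$, and put $A=a_{12}+a_{21}$, $B=b_{12}+b_{21}$, such that in all cases $$e_1e_1=e_1,\quad e_1e_2=a_{12}e_1+b_{12}e_2,\quad e_2e_1=a_{21}e_1+b_{21}e_2,$$ and one of the following holds: (1) $e_2e_2=a_{22}e_1+b_{22}e_2$ with $b_{22}\neq 0$ and $B=0$; (2) $e_2e_2=-e_1$ and $B\neq 0$; (3) $e_2e_2=e_1$, and $|A|<2$ or $B\neq 0$; (4) $e_2e_2=e_2$ and $AB\neq 1$. Then: (a) for every $c\in\mathbb{R}^2$ the filled Julia set $\mathcal{K}_{\mathbb{R}^{2}}(f_{c})$ associated with $f_{c}$ is a compact subset of $\mathbb{R}^{2}$; (b) the Mandelbrot set $\mathcal{M}_{\mathbb{R}^{2}}$ is a compact subset of $\mathbb{R}^{2}$.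
   Context: A real nonassociative algebra is a real vector space with a bilinear multiplication (not necessarily associative, commutative or unital). The norm on $\mathbb{R}^2$ is the one for which the basis $\{e_1,e_2\}$ is orthonormal: $\|ae_1+be_2\|=\sqrt{a^2+b^2}$ for real $a,b$. For $c\in\mathbb{R}^2$, $f_c(u)=u^2+c$ (with $u^2=u\cdot u$ the algebra product); $f_c^{1}=f_c$ and $f_c^{n}(u)=f_c(f_c^{n-1}(u))$. The filled Julia set $\mathcal{K}_{\mathbb{R}^2}(f_c)$ is the set of all $u$ for which there exists a real $\zeta_u>0$ with $\|f_c^n(u)\|\leq\zeta_u$ for every positive integer $n$. The Mandelbrot set $\mathcal{M}_{\mathbb{R}^2}$ is the set of all $c$ for which there exists a real $\zeta_c>0$ with $\|f_c^n(0)\|\leq\zeta_c$ for every positive integer $n$. The empty set is regarded as compact. *)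

(* Defs.v *)
From HB Require Import structures.
From mathcomp Require Import all_boot all_order all_algebra.
From mathcomp Require Import all_classical all_reals all_analysis.
Set Implicit Arguments.
Unset Strict Implicit.
Unset Printing Implicit Defensive.
Import Order.TTheory GRing.Theory Num.Theory.
Import numFieldNormedType.Exports.
Local Open Scope classical_set_scope.
Local Open Scope ring_scope.

Section JuliaMandelbrot.
Variable R : realType.
Variables (e1 e2 : 'rV[R]_2).
Implicit Types c u : 'rV[R]_2.
Implicit Types mul : 'rV[R]_2 -> 'rV[R]_2 -> 'rV[R]_2.

(* The Euclidean norm making the basis (e1, e2) orthonormal; the library norm
   `|u| on 'rV[R]_2 is instead the sup norm of the canonical coordinates. *)
Definition basis_norm u : R :=
  Num.sqrt (\sum_(i < 2) coord [tuple e1; e2] i u ^+ 2).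

Definition quad_map mul c u : 'rV[R]_2 := mul u u + c.

Definition filled_julia mul c : set 'rV[R]_2 :=
  [set u | exists2 zeta : R, 0 < zeta &
     forall n : nat, (0 < n)%N ->
       basis_norm (iter n (quad_map mul c) u) <= zeta].

Definition mandelbrot mul : set 'rV[R]_2 :=
  [set c | exists2 zeta : R, 0 < zeta &
     forall n : nat, (0 < n)%N ->
       basis_norm (iter n (quad_map mul c) 0) <= zeta].

Lemma basis_normE (a b : R) : basis_of fullv [:: e1; e2] ->
  basis_norm (a *: e1 + b *: e2) = Num.sqrt (a ^+ 2 + b ^+ 2).
Proof.
move=> /basis_free e_free; rewrite /basis_norm; congr Num.sqrt.
have cE (i : 'I_2) :
    coord [tuple e1; e2] i (a *: e1 + b *: e2) = if i == 0 then a else b.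
  pose k (j : 'I_2) := if j == 0 then a else b.
  rewrite -[RHS]/(k i) -(coord_sum_free k i e_free).
  by congr coord; rewrite big_ord_recl big_ord1.
by rewrite big_ord_recl big_ord1 !cE.
Qed.

End JuliaMandelbrot.

(* Main.v *)
Require Import Defs.
From mathcomp Require Import all_boot all_order all_algebra.
From mathcomp Require Import all_classical all_reals all_analysis.
From mathcomp Require Import ring lra.
Set Implicit Arguments.
Unset Strict Implicit.
Import Order.TTheory GRing.Theory Num.Theory.
Import numFieldNormedType.Exports.
Local Open Scope classical_set_scope.
Local Open Scope ring_scope.

(** The four cases have one thing in common: the algebra has no nonzero element
of square zero. This alone implies compactness, in the following way.

The squaring map [q u = mul u u] is continuous and homogeneous of degree two.
If it vanishes only at the origin, then on the compact unit sphere [`|q u|] has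
a positive minimum [m], and homogeneity gives [m * `|u| ^+ 2 <= `|q u|] for all
[u] ([anisotropic_lower_bound]). Hence squaring dominates far from the origin:
a point [u] with [`|u| >= `|c|] and [`|u| > 2 / m] has an unbounded orbit under
[u |-> q u + c] ([orbit_escapes]). So an orbit is bounded if and only if it
stays in the ball of radius [Num.max `|c| (2 / m)], and this turns the filled
Julia set into an intersection of closed conditions on [u], the zeroth of which
says that [u] lies in a ball. For the Mandelbrot set the orbit of the origin
passes through [c] itself, which forces [`|c| <= 2 / m] and makes the radius
[2 / m] independent of [c]; the same argument applies in the variable [c], with
boundedness now given by the first iterate.

Boundedness of orbits does not see the difference between the sup norm and the
norm attached to the basis [e1, e2], because the two are equivalent
([basis_norm_bounded_orbit]). What remains is algebra in two unknowns: solving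
[mul u u = 0] in coordinates in each of the four cases
([quadratic_pair_eq0]). *)

(** * Escape to infinity *)

Definition bounded_orbit {R : numDomainType} {V : normedZmodType R}
    (f : V -> V) (u : V) :=
  exists M : R, forall n, `|iter n f u| <= M.

(** While [`|v| >= `|u|], one step gives
[`|q v + c| >= m * `|v| ^+ 2 - `|c| >= m * `|u| * `|v| - `|v|], which exceeds
[`|v|] by at least [(m * `|u| - 2) * `|u| > 0]. So the norm grows at least
linearly along the orbit. (The true growth is doubly exponential; linear growth
is enough to leave every ball.) *)
Lemma orbit_escapes (R : realType) (V : normedModType R)
    (q : V -> V) (m : R) (c u : V) :
  0 < m -> (forall v, m * `|v| ^+ 2 <= `|q v|) ->
  `|c| <= `|u| -> 2 / m < `|u| ->
  forall B, exists n, B < `|iter n (fun v => q v + c) u|.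
Proof.
move=> m_gt0 hq cu u_gt B; set f := fun v => q v + c.
pose d := (m * `|u| - 2) * `|u|.
have k_gt0 : 0 < m * `|u| - 2 by rewrite subr_gt0 mulrC -ltr_pdivrMr.
have u_gt0 : 0 < `|u| by apply: le_lt_trans u_gt; rewrite divr_ge0// ltW.
have d_gt0 : 0 < d by rewrite mulr_gt0.
have growth n : `|u| + n%:R * d <= `|iter n f u|.
  elim: n => [|n IH]; first by rewrite mul0r addr0.
  rewrite iterS; set v := iter n f u in IH *.
  have nd_ge0 : 0 <= n%:R * d by rewrite mulr_ge0// ltW.
  have uv : `|u| <= `|v| by lra.
  have fv : m * `|v| ^+ 2 - `|c| <= `|f v|.
    by rewrite /f (le_trans _ (lerB_normD _ _))// lerB.
  have d_le : d <= (m * `|u| - 2) * `|v| by rewrite ler_wpM2l// ltW.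
  have mvv : m * `|u| * `|v| <= m * `|v| ^+ 2.
    by rewrite -mulrA expr2 ler_wpM2l ?(ltW m_gt0)// ler_wpM2r.
  rewrite -natr1; lra.
exists (Num.truncn (B / d)).+1; apply: lt_le_trans (growth _).
rewrite -ltrBlDl (@lt_trans _ _ B)// ?ltrBlDl ?ltrDr//.
by rewrite -ltr_pdivrMr// truncnS_gt.
Qed.

(** A tail of an orbit is an orbit, so a bounded orbit may not enter the escape
region at any time. *)
Lemma bounded_orbit_in_ball (R : realType) (V : normedModType R)
    (q : V -> V) (m : R) (c u : V) :
  0 < m -> (forall v, m * `|v| ^+ 2 <= `|q v|) ->
  bounded_orbit (fun v => q v + c) u ->
  forall n, `|iter n (fun v => q v + c) u| <= Num.max `|c| (2 / m).
Proof.
move=> m_gt0 hq [M uM] n; rewrite leNgt; apply/negP.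
rewrite gt_max => /andP[/ltW hc hm].
have [k] := orbit_escapes m_gt0 hq hc hm M.
by rewrite -iterD ltNge uM.
Qed.

(** * Compactness of the sets of bounded orbits *)

(** Both the parameter and the starting point may vary: the filled Julia set
fixes [c] and moves [u], the Mandelbrot set does the converse. *)
Lemma continuous_iter (R : realType) (T : topologicalType) (V : normedModType R)
    (q : V -> V) (c u : T -> V) n :
  continuous q -> continuous c -> continuous u ->
  continuous (fun x => iter n (fun v => q v + c x) (u x)).
Proof.
move=> qc cc uc; elim: n => [//|n IH] x /=.
apply: continuousD; last exact: cc.
by apply: (continuous_comp (f := fun x => iter n _ _)); [exact: IH|exact: qc].
Qed.

(** Closedness comes from all the [F n] together, boundedness from the single
index [i] at which [F i] is the identity: 0 for a family of orbits indexed by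
the starting point, 1 for the orbits of the origin indexed by [c]. *)
Lemma compact_bounded_family (R : realType) k
    (F : nat -> 'rV[R]_k -> 'rV[R]_k) (i : nat) (rho : R)
    (A : set 'rV[R]_k) :
  (forall n, continuous (F n)) -> F i = id ->
  A = [set x | forall n, `|F n x| <= rho] -> compact A.
Proof.
move=> Fc Fi ->; apply: bounded_closed_compact.
  exists rho; split=> [|M /ltW rhoM x /= /(_ i)]; first exact: num_real.
  by rewrite Fi => /le_trans; apply.
have -> : [set x | forall n, `|F n x| <= rho] =
    \bigcap_(n in setT) (fun x => `|F n x|) @^-1` [set y | y <= rho].
  by apply/seteqP; split => [x h n _|x h n]; exact: h.
apply: closed_bigI => n _; apply: preimage_closed; last exact: closed_le.
move=> x _; apply: (@continuous_comp _ _ _ (F n) Num.norm); first exact: Fc.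
exact: norm_continuous.
Qed.

Lemma compact_bounded_orbit (R : realType) k (q : 'rV[R]_k -> 'rV[R]_k) m c :
  0 < m -> (forall v, m * `|v| ^+ 2 <= `|q v|) -> continuous q ->
  compact [set u | bounded_orbit (fun v => q v + c) u].
Proof.
move=> m_gt0 hq qc.
apply: (@compact_bounded_family R k
  (fun n u => iter n (fun v => q v + c) u) 0 (Num.max `|c| (2 / m))) => //.
  move=> n; apply: (@continuous_iter _ _ _ q (cst c) id n qc) => x.
    exact: cst_continuous.
  exact: cvg_id.
apply/seteqP; split => u /=; first exact: bounded_orbit_in_ball.
by exists (Num.max `|c| (2 / m)).
Qed.

(** The origin is a critical point of [q], and its first iterate is [c]; if
[`|c| > 2 / m] then [c] meets the escape condition for its own parameter. *)
Lemma compact_bounded_critical_orbit (R : realType) k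
    (q : 'rV[R]_k -> 'rV[R]_k) m :
  0 < m -> (forall v, m * `|v| ^+ 2 <= `|q v|) -> continuous q -> q 0 = 0 ->
  compact [set c | bounded_orbit (fun v => q v + c) 0].
Proof.
move=> m_gt0 hq qc q0.
apply: (@compact_bounded_family R k
  (fun n c => iter n (fun v => q v + c) 0) 1 (2 / m)) => //.
- move=> n; apply: (@continuous_iter _ _ _ q id (cst 0) n qc) => x.
    exact: cvg_id.
  exact: cst_continuous.
- by apply/funext => c /=; rewrite q0 add0r.
apply/seteqP; split => c /=; last by exists (2 / m).
move=> cB; have [c_le|c_gt] := leP `|c| (2 / m).
  move=> n; have := bounded_orbit_in_ball m_gt0 hq cB n.
  by rewrite max_r.
have [M cM] := cB.
have [n] := orbit_escapes m_gt0 hq (lexx _) c_gt M.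
by have := cM n.+1; rewrite iterSr q0 add0r leNgt => /negP.
Qed.

(** * Continuity and anisotropy of quadratic maps in finite dimension *)

Lemma continuous_sum (R : numFieldType) (T : topologicalType)
    (V : normedModType R) (I : Type) (r : seq I) (P : pred I)
    (F : I -> T -> V) :
  (forall i, P i -> continuous (F i)) ->
  continuous (fun x => \sum_(i <- r | P i) F i x).
Proof.
move=> Fc; rewrite -fct_sumE; elim/big_ind: _ => // [|g h gc hc x].
  by move=> x; exact: cvg_cst.
by apply: continuousD; [exact: gc|exact: hc].
Qed.

Lemma continuous_linear_rV (R : realType) k (W : normedModType R)
    (f : {linear 'rV[R]_k -> W}) : continuous f.
Proof.
rewrite [X in continuous X](_ : _ = fun u : 'rV_k =>
    \sum_i u ord0 i *: f (delta_mx ord0 i)).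
  apply: continuous_sum => i _ u.
  by apply: continuousZr_tmp; exact: coord_continuous.
apply/funext => u; rewrite [in LHS](row_sum_delta u) linear_sum/=.
by apply: eq_bigr => i _; rewrite linearZ.
Qed.

Lemma continuous_sqr_rV (R : realType) k (W : normedModType R)
    (mul : {bilinear 'rV[R]_k -> 'rV[R]_k -> W}) :
  continuous (fun u => mul u u).
Proof.
rewrite [X in continuous X](_ : _ = fun u : 'rV_k =>
    \sum_i u ord0 i *: mul (delta_mx ord0 i) u).
  apply: continuous_sum => i _ u.
  apply: continuousZ; first exact: coord_continuous.
  exact: continuous_linear_rV.
apply/funext => u; rewrite [X in mul X _](row_sum_delta u) linear_sumlz/=.
by apply: eq_bigr => i _; rewrite linearZl_LR.
Qed.

(** The constant is the minimum of [`|q u|] over the unit sphere, which spreads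
to all vectors by homogeneity. *)
Lemma anisotropic_lower_bound (R : realType) k (W : normedModType R)
    (q : 'rV[R]_k -> W) :
  continuous q -> (forall a u, q (a *: u) = a ^+ 2 *: q u) ->
  (forall u, q u = 0 -> u = 0) ->
  exists2 m : R, 0 < m & forall u, m * `|u| ^+ 2 <= `|q u|.
Proof.
move=> qc qZ q_eq0; pose S := [set u : 'rV[R]_k | `|u| = 1].
suff [m m_gt0 hm] : exists2 m : R, 0 < m & forall u, S u -> m <= `|q u|.
  exists m => // u; have [->|u_neq0] := eqVneq u 0.
    by rewrite normr0 expr0n mulr0.
  have nu_gt0 : 0 < `|u| by rewrite normr_gt0.
  have := hm (`|u|^-1 *: u).
  rewrite /S/= normrZ ger0_norm ?invr_ge0// mulVf ?gt_eqF// qZ normrZ.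
  rewrite ger0_norm ?exprn_ge0 ?invr_ge0// exprVn.
  by rewrite ler_pdivlMl ?exprn_gt0// mulrC; exact.
(* The sphere is empty when [k = 0]; any positive constant then works. *)
have [S0|/nonemptyPn S0] := pselect (S !=set0); last first.
  by exists 1 => // u; rewrite S0.
have Sc : compact S.
  apply: bounded_closed_compact.
    by exists 1; split=> [|M /ltW M_ge1 u /= ->]; first exact: num_real.
  apply: (@preimage_closed _ _ (fun u : 'rV[R]_k => `|u|) [set 1]).
    by move=> u _; exact: norm_continuous.
  exact: closed_eq.
have nqc : continuous (fun u => `|q u|).
  move=> x; apply: (@continuous_comp _ _ _ q Num.norm); first exact: qc.
  exact: norm_continuous.
have [u /set_mem Su hu] := EVT_min_rV S0 Sc (continuous_subspaceT nqc).
exists `|q u| => [|v Sv]; last by apply: hu; rewrite inE.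
rewrite normr_gt0; apply/eqP => /q_eq0 u0.
by move: Su; rewrite /S/= u0 normr0 => /esym/eqP; rewrite oner_eq0.
Qed.

(** * The norm attached to a basis of the plane *)

Section BasisNorm.
Variables (R : realType) (e1 e2 : 'rV[R]_2).
Hypothesis he : basis_of fullv [:: e1; e2].
Let e := [tuple e1; e2].

Lemma basis_decomposition u :
  u = coord e ord0 u *: e1 + coord e ord_max u *: e2.
Proof.
rewrite {1}(coord_basis (he : basis_of fullv e) (memvf u)).
rewrite big_ord_recl big_ord1; congr (_ + coord e _ u *: _).
exact: val_inj.
Qed.

Lemma basis_normE2 u :
  basis_norm e1 e2 u = Num.sqrt (coord e ord0 u ^+ 2 + coord e ord_max u ^+ 2).
Proof. by rewrite {1}(basis_decomposition u) basis_normE. Qed.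

Lemma norm_le_basis_norm u : `|u| <= (`|e1| + `|e2|) * basis_norm e1 e2 u.
Proof.
rewrite basis_normE2 {1}(basis_decomposition u).
set a := coord _ _ _; set b := coord _ _ _.
rewrite (le_trans (ler_normD _ _))// !normrZ mulrDl.
have sqrt_ge (x y : R) : `|x| <= Num.sqrt (x ^+ 2 + y ^+ 2).
  by rewrite -sqrtr_sqr ler_wsqrtr// lerDl sqr_ge0.
rewrite [`|e1| * _]mulrC [`|e2| * _]mulrC lerD// ler_wpM2r//.
by rewrite addrC.
Qed.

(** The coordinate functions are linear forms on a finite-dimensional space,
hence continuous, hence bounded by a multiple of the norm. *)
Lemma basis_norm_le_norm : exists C, forall u, basis_norm e1 e2 u <= C * `|u|.
Proof.
have coord_bound i : exists C, forall u, `|coord e i u| <= C * `|u|.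
  have /linear_bounded_continuous/linear_boundedP :=
    @continuous_linear_rV R 2 R^o (coord e i).
  by move=> /pinfty_ex_gt0[C _ hC]; exists C.
have [C0 h0] := coord_bound ord0; have [C1 h1] := coord_bound ord_max.
exists (C0 + C1) => u; rewrite basis_normE2 mulrDl.
apply: le_trans (lerD (h0 u) (h1 u)).
rewrite -[leRHS]ger0_norm ?addr_ge0// -sqrtr_sqr ler_wsqrtr//.
rewrite sqrrD !real_normK ?num_real//.
by rewrite -addrA lerD2l lerDr mulrn_wge0// mulr_ge0.
Qed.

(** Equivalence of the two norms; the initial point, which is left out on the
left-hand side, is a single vector and cannot affect boundedness. *)
Lemma basis_norm_bounded_orbit (f : 'rV[R]_2 -> 'rV[R]_2) u :
  (exists2 zeta : R, 0 < zeta &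
     forall n, (0 < n)%N -> basis_norm e1 e2 (iter n f u) <= zeta) <->
  bounded_orbit f u.
Proof.
split=> [[zeta zeta_gt0 hz]|[M hM]].
  have C_ge0 : 0 <= `|e1| + `|e2| by rewrite addr_ge0.
  exists (`|u| + (`|e1| + `|e2|) * zeta) => -[|n].
    by rewrite lerDl mulr_ge0// ltW.
  rewrite (le_trans (norm_le_basis_norm _))// ler_wpDl// ler_wpM2l//.
  exact: hz.
have [C hC] := basis_norm_le_norm.
exists (1 + `|C| * M) => [|n _].
  by rewrite ltr_pwDl// mulr_ge0// (le_trans _ (hM 0%N)).
rewrite (le_trans (hC _))// ler_wpDl// (@le_trans _ _ (`|C| * `|iter n f u|))//.
  by rewrite ler_wpM2r// ler_norm.
by rewrite ler_wpM2l.
Qed.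

Lemma free_pair_eq0 (a b : R) : a *: e1 + b *: e2 = 0 -> a = 0 /\ b = 0.
Proof.
move=> ab0; have := basis_normE a b he.
have := basis_normE 0 0 he; rewrite !scale0r addr0 ab0 => ->.
rewrite !expr0n addr0 sqrtr0 => /esym/eqP.
rewrite sqrtr_eq0 => ab_le0.
have [a2 b2] : a ^+ 2 = 0 /\ b ^+ 2 = 0.
  by have := sqr_ge0 a; have := sqr_ge0 b; split; lra.
by split; apply/eqP; rewrite -sqrf_eq0 ?a2 ?b2.
Qed.

Lemma sqr_basis (mul : {bilinear 'rV[R]_2 -> 'rV[R]_2 -> 'rV[R]_2})
    (a12 a21 a22 b12 b21 b22 x y : R) :
  mul e1 e1 = e1 ->
  mul e1 e2 = a12 *: e1 + b12 *: e2 ->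
  mul e2 e1 = a21 *: e1 + b21 *: e2 ->
  mul e2 e2 = a22 *: e1 + b22 *: e2 ->
  mul (x *: e1 + y *: e2) (x *: e1 + y *: e2) =
    (x ^+ 2 + (a12 + a21) * (x * y) + a22 * y ^+ 2) *: e1 +
    ((b12 + b21) * (x * y) + b22 * y ^+ 2) *: e2.
Proof.
move=> h11 h12 h21 h22.
rewrite [in LHS]linearDl ![in LHS]linearDr ![in LHS]linearZl_LR.
rewrite ![in LHS]linearZr_LR /= h11 h12 h21 h22.
by apply/rowP => j; rewrite !mxE; ring.
Qed.

End BasisNorm.

(** * Plane algebras without square-zero elements *)

Theorem compact_julia_mandelbrot (R : realType)
  (mul : {bilinear 'rV[R]_2 -> 'rV[R]_2 -> 'rV[R]_2})
  (e1 e2 : 'rV[R]_2) (he : basis_of fullv [:: e1; e2]) :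
  (forall u, mul u u = 0 -> u = 0) ->
  (forall c : 'rV[R]_2, compact (filled_julia e1 e2 mul c)) /\
  compact (mandelbrot e1 e2 mul).
Proof.
move=> sqr_eq0; pose q u := mul u u.
have qc : continuous q by exact: continuous_sqr_rV.
have qZ a u : q (a *: u) = a ^+ 2 *: q u.
  by rewrite /q linearZl_LR linearZr_LR /= scalerA -expr2.
have [m m_gt0 hm] := anisotropic_lower_bound qc qZ sqr_eq0.
split=> [c|].
  rewrite (_ : filled_julia _ _ _ _ =
    [set u | bounded_orbit (quad_map mul c) u]).
    exact: compact_bounded_orbit m_gt0 hm qc.
  by apply/seteqP; split=> u /(basis_norm_bounded_orbit he).
rewrite (_ : mandelbrot _ _ _ = [set c | bounded_orbit (quad_map mul c) 0]).
  apply: compact_bounded_critical_orbit m_gt0 hm qc _.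
  by rewrite /q linear0r.
by apply/seteqP; split=> u /(basis_norm_bounded_orbit he).
Qed.

(** The two equations are the coordinates of [mul u u = 0] for
[u = x *: e1 + y *: e2] and [mul e2 e2 = p *: e1 + q *: e2]. In the first case
the second equation is [q * y ^+ 2 = 0]; for [p = 1] and [`|A| < 2] the first
equation is a definite quadratic form; for the remaining cases with [q = 0] the
second equation is [B * (x * y) = 0]. In the last case the equations factor as
[x * (x + A * y) = 0] and [y * (B * x + y) = 0], and the two lines
[x + A * y = 0] and [B * x + y = 0] coincide only if [A * B = 1]. *)
Lemma quadratic_pair_eq0 (R : realType) (A B p q x y : R) :
  [\/ q <> 0 /\ B = 0,
      [/\ p = -1, q = 0 & B <> 0],
      [/\ p = 1, q = 0 & `|A| < 2 \/ B <> 0] |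
      [/\ p = 0, q = 1 & A * B <> 1]] ->
  x ^+ 2 + A * (x * y) + p * y ^+ 2 = 0 ->
  B * (x * y) + q * y ^+ 2 = 0 ->
  x = 0 /\ y = 0.
Proof.
have sqr_eq0 (z : R) : z ^+ 2 = 0 -> z = 0.
  by move/eqP; rewrite sqrf_eq0 => /eqP.
have mul_eq0 (z t : R) : z * t = 0 -> z = 0 \/ t = 0.
  by move/eqP; rewrite mulf_eq0 => /orP[]/eqP; [left|right].
case=> [[q0 ->]|[-> -> B0]|[-> -> AB]|[-> -> AB]] P Q.
- have y0 : y = 0.
    by move: Q; rewrite mul0r add0r => /mul_eq0[//|/sqr_eq0].
  by split=> //; apply: sqr_eq0; rewrite y0 in P; lra.
- have [//|xy0] : B = 0 \/ x * y = 0 by apply: mul_eq0; lra.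
  have xy2 : x ^+ 2 = y ^+ 2 by rewrite xy0 in P; lra.
  case: (mul_eq0 _ _ xy0) => z0; split=> //; apply: sqr_eq0;
    by move: xy2; rewrite z0 expr0n.
- case: AB => [A_lt2|B0].
    move: A_lt2; rewrite ltr_norml => /andP[A1 A2].
    have y0 : y = 0.
      (* Completing the square: (2 x + A y)^2 + (4 - A^2) y^2 = 0. *)
      apply: sqr_eq0; apply/eqP; case: eqP => // /eqP y2.
      have : 0 < y ^+ 2 by rewrite lt_neqAle eq_sym y2 sqr_ge0.
      have : 0 < (2 - A) * (2 + A) by rewrite mulr_gt0; lra.
      move=> h1 h2; have := mulr_gt0 h1 h2; have := sqr_ge0 (2 * x + A * y).
      by nra.
    by split=> //; apply: sqr_eq0; rewrite y0 in P; lra.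
  have [//|xy0] : B = 0 \/ x * y = 0 by apply: mul_eq0; lra.
  rewrite xy0 in P; have := sqr_ge0 x; have := sqr_ge0 y.
  by split; apply: sqr_eq0; lra.
have [x0|xAy] : x = 0 \/ x + A * y = 0 by apply: mul_eq0; rewrite -P; ring.
  by split=> //; apply: sqr_eq0; rewrite x0 in Q; lra.
have [y0|Bxy] : y = 0 \/ B * x + y = 0 by apply: mul_eq0; rewrite -Q; ring.
  by split=> //; rewrite y0 in xAy; lra.
have [AB1|y0] : 1 - A * B = 0 \/ y = 0.
- apply: mul_eq0.
  have -> : (1 - A * B) * y = (B * x + y) - B * (x + A * y) by ring.
  by rewrite Bxy xAy mulr0 subr0.
- by case: AB; lra.
by split=> //; rewrite y0 in xAy; lra.
Qed.

Theorem corollary5p1 (R : realType)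
  (mul : {bilinear 'rV[R]_2 -> 'rV[R]_2 -> 'rV[R]_2})
  (e1 e2 : 'rV[R]_2) (he : basis_of fullv [:: e1; e2])
  (a12 a21 a22 b12 b21 b22 : R)
  (h11 : mul e1 e1 = e1)
  (h12 : mul e1 e2 = a12 *: e1 + b12 *: e2)
  (h21 : mul e2 e1 = a21 *: e1 + b21 *: e2)
  (h22 : let A := a12 + a21 in
         let B := b12 + b21 in
         [\/ [/\ mul e2 e2 = a22 *: e1 + b22 *: e2, b22 <> 0 & B = 0],
             mul e2 e2 = - e1 /\ B <> 0,
             mul e2 e2 = e1 /\ (`|A| < 2 \/ B <> 0) |
             mul e2 e2 = e2 /\ A * B <> 1]) :
  (forall c : 'rV[R]_2, compact (filled_julia e1 e2 mul c)) /\
  compact (mandelbrot e1 e2 mul).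
Proof.
have [p [q [e22 pq]]] : exists p q, mul e2 e2 = p *: e1 + q *: e2 /\
    [\/ q <> 0 /\ b12 + b21 = 0,
        [/\ p = -1, q = 0 & b12 + b21 <> 0],
        [/\ p = 1, q = 0 & `|a12 + a21| < 2 \/ b12 + b21 <> 0] |
        [/\ p = 0, q = 1 & (a12 + a21) * (b12 + b21) <> 1]].
  case: h22 => [[-> ? ?]|[-> ?]|[-> ?]|[-> ?]].
  - by exists a22, b22; split=> //; constructor 1.
  - exists (-1), 0; rewrite scaleN1r scale0r addr0; split=> //.
    by constructor 2.
  - exists 1, 0; rewrite scale1r scale0r addr0; split=> //.
    by constructor 3.
  - exists 0, 1; rewrite scale1r scale0r add0r; split=> //.
    by constructor 4.
apply: compact_julia_mandelbrot => // u; rewrite (basis_decomposition he u).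
rewrite (sqr_basis _ _ h11 h12 h21 e22) => /(free_pair_eq0 he)[P Q].
have [-> ->] := quadratic_pair_eq0 pq P Q.
by rewrite !scale0r addr0.
Qed.
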